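(* The optimization problem $(\mathcal P)$ defined in the context, which includes nonlinear constraints (specifically (C1), (C5), (C8), (C9), (C10), (C13), (C18) and (C19)), is equivalent to a mixed-integer linear program (MILP), in the sense that the optimal values of the two problems coincide and solutions to either problem can be derived from solutions to the other.
   Context: **Time indices and data.** $J\ge 1$ is an integer and $\mathbb J=\{1,\dots,J\}$ is the set of days. $\underline{\mathbb J}=\{\underline j: j\in\mathbb J\}$ and $\overline{\mathbb J}=\{\overline j: j\in\mathbb J\}$ are two disjoint copies of $\mathbb J$ (first and second part of each day), and $\widehat{\mathbb J}=\underline{\mathbb J}\cup\overline{\mathbb J}\cup\{\overline 0\}$ is totally ordered by $\overline 0\prec\underline 1\prec\overline 1\prec\dots\prec\underline J\prec\overline J$. $i^+$ and $i^-$ denote successor and predecessor, so $\underline j^+=\overline j$, $\underline j^-=\overline{j-1}$, $\overline j^-=\underline j$. $\mathbb H=\{0,\dots,23\}$ is the set of hours; $[n]=\{1,\dots,n\}$; $\mathbf 1_A$ is the indicator function of $A$. $\mathbb S$ (sources), $\mathbb D=\{d_1,\dots,d_{|\mathbb D|}\}$ (destinations), $\mathbb B$ (storages) are finite sets, $\mathbb S\cap\mathbb D=\emptyset$. Further data: $\kappa:\mathbb S\to\mathbb N$; the storage capacity $X^{\max}$; $\overline r_s\ge 0$ for $s\in\mathbb S$; $h_0\in\mathbb H$; $g:\mathbb S\times\mathbb D\to\mathbb R_+$; hourly demands $q_{d,j,h}\ge 0$ with cumulative demands $C_{d,j,h}=\sum_{h'=0}^{h}q_{d,j,h'}$, where $C_{d,j,23}\le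 X^{\max}$; transport times $t_{(p_1,p_2)}\ge0$ with $t_{(d,d)}=0$; unit costs $c^{\mathrm{tr}},c^{\mathrm{re}}_s,c^{\mathrm{v}},c^{\mathrm{f}}\ge 0$. **Time-expanded graph.** Nodes are elements of $(\mathbb S\cup\mathbb D)\times\widehat{\mathbb J}$. The arc set is $\mathcal A=\underline{\mathcal A}\cup\overline{\mathcal A}\cup\widetilde{\mathcal A}$ with $\underline{\mathcal A}=\big((\mathbb S\times\mathbb D)\cup\{(d,d):d\in\mathbb D\}\big)\times\underline{\mathbb J}$, $\overline{\mathcal A}=\big((\mathbb D\times\mathbb S)\cup\{(d,d):d\in\mathbb D\}\big)\times(\overline{\mathbb J}\cup\{\overline 0\})$, $\widetilde{\mathcal A}=\{(s{:}k): s\in\mathbb S,k\in[\kappa(s)]\}\times\widehat{\mathbb J}$. An arc $(v,v',i)$ goes from $(v,i)$ to $(v',i^+)$; the arc $(s{:}k,i)$ is the $k$-th parallel arc from $(s,i)$ to $(s,i^+)$. **Variables.** Hydrogen flow $f_a\in[0,X^{\max}]$ and storage flow $y_a\in\{0,1\}$ for $a\in\mathcal A$ (their values on arcs with time index $\overline 0$ are given data, with $\sum y_a=|\mathbb B|$ over these arcs); $z_{d,i}\in[0,X^{\max}]$ for $d\in\mathbb D$, $i\in\underline{\mathbb J}\cup\overline{\mathbb J}$; swap hours $\eta_{d,j}\in\mathbb H$ for $d\in\mathbb D,j\in\mathbb J$; refills $r_{s,\underline j}\in[0,\overline r_s]$; and, for each $(s,\underline j)$, a bijection $\sigma_{s,\underline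 j}$ described in (C18). The quantities $D_{d,\underline j},D_{d,\overline j}$ are defined by (C4) and (C12). **Constraints** (for all $s\in\mathbb S$, $d\in\mathbb D$, $j\in\mathbb J$ unless otherwise specified): (C1) for all $a\in\mathcal A$: $f_a>0\Rightarrow y_a=1$ (equivalently $y_a=0\Rightarrow f_a=0$). (C2) $y_{d,d,i}=1$ for all $i\in\widehat{\mathbb J}$. (C3) $f_{d,d,\underline j}=f_{d,d,\underline j^-}-z_{d,\underline j}$. (C4) $D_{d,\underline j}=\sum_{h\in\mathbb H}\mathbf 1_{\{h\}}(\eta_{d,j})\,C_{d,j,h}$. (C5) $z_{d,\underline j}=\min(f_{d,d,\underline j^-},D_{d,\underline j})$. (C6) $\sum_{s\in\mathbb S}y_{s,d,\underline j}\le 1$. (C7) $\sum_{s\in\mathbb S}y_{s,d,\underline j}=\sum_{s\in\mathbb S}y_{d,s,\overline j}$. (C8) $f_{d,d,\underline j}=\mathbf 1_{\{0\}}\big(\sum_{s}y_{s,d,\underline j}\big)f_{d,d,\underline j}+\sum_{s}f_{d,s,\overline j}$. (C9) $f_{d,d,\overline j}=\sum_{s}f_{s,d,\underline j}+\mathbf 1_{\{0\}}\big(\sum_{s}y_{s,d,\underline j}\big)f_{d,d,\underline j}-z_{d,\overline j}$. (C10) $y_{s,d,\underline j}=1\Rightarrow \eta_{d,j}=h_0+g(s,d)$. (C11) $\sum_{s}y_{s,d,\underline j}=0\Rightarrow \eta_{d,j}=(23+0+1)/2=12$. (C12) $D_{d,\overline j}=C_{d,j,23}-D_{d,\underline j}$.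 (C13) $z_{d,\overline j}=\min(f_{d,d,\underline j},D_{d,\overline j})$. (C14) $\sum_{d\in\mathbb D}y_{d,s,\underline j^-}+\sum_{k\in[\kappa(s)]}y_{s:k,\underline j^-}\le\kappa(s)$. (C15) $\sum_{d}y_{d,s,\underline j^-}+\sum_{k}y_{s:k,\underline j^-}=\sum_{d}y_{s,d,\underline j}+\sum_{k}y_{s:k,\underline j}$. (C16) $\sum_{d}f_{d,s,\underline j^-}+\sum_{k}f_{s:k,\underline j^-}+r_{s,\underline j}=\sum_{d}f_{s,d,\underline j}+\sum_{k}f_{s:k,\underline j}$. (C17) $r_{s,\underline j}\le\overline r_s$. (C18) Let $N_s=[|\mathbb D|+\kappa(s)]$. For $l\in N_s$ put $f^{\mathrm{in}}_{s,\underline j,l}=f_{d_l,s,\underline j^-}$ if $l\le|\mathbb D|$ and $f_{s:(l-|\mathbb D|),\underline j^-}$ otherwise; $f^{\mathrm{out}}_{s,\underline j,l}=f_{s,d_l,\underline j}$ if $l\le|\mathbb D|$ and $f_{s:(l-|\mathbb D|),\underline j}$ otherwise; define $y^{\mathrm{in}}_{s,\underline j,l}$, $y^{\mathrm{out}}_{s,\underline j,l}$ in the same way with $y$ in place of $f$. Let $I_{s,\underline j}=\{l\in N_s:y^{\mathrm{in}}_{s,\underline j,l}=1\}$ and $O_{s,\underline j}=\{l\in N_s:y^{\mathrm{out}}_{s,\underline j,l}=1\}$ (of equal cardinality by (C15)). Then $\sigma_{s,\underline j}:I_{s,\underline j}\to O_{s,\underline j}$ is a bijection with $f^{\mathrm{in}}_{s,\underline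 j,l}\le f^{\mathrm{out}}_{s,\underline j,\sigma_{s,\underline j}(l)}$ for all $l\in I_{s,\underline j}$. (C19) if $\kappa(s)\ge2$, for all $k\in[\kappa(s)-1]$: $y_{s:(k+1),\underline j}=1\Rightarrow y_{s:k,\underline j}=1$. (C20) for all $k\in[\kappa(s)]$: $f_{s:k,\underline j}=f_{s:k,\overline j}$ and $y_{s:k,\underline j}=y_{s:k,\overline j}$. **Problem $(\mathcal P)$.** Minimize over $(y,f,r,z,\eta,\sigma)$, subject to (C1)–(C20), the sum of $c^{\mathrm{tr}}\sum_{(p_1,p_2,i)\in\underline{\mathcal A}\cup\overline{\mathcal A}}t_{(p_1,p_2)}y_{p_1,p_2,i}$, $\sum_{(s,j)\in\mathbb S\times\mathbb J}c^{\mathrm{re}}_s r_{s,\underline j}$, $c^{\mathrm v}\sum_{(d,j)\in\mathbb D\times\mathbb J}\Delta_{d,j}$ and $c^{\mathrm f}\sum_{(d,j)\in\mathbb D\times\mathbb J}\mathbf 1_{\{\Delta_{d,j}>0\}}$, where $\Delta_{d,j}=D_{d,\underline j}+D_{d,\overline j}-(z_{d,\underline j}+z_{d,\overline j})$. A MILP is the minimization of a linear objective in finitely many real and integer (binary) variables subject to finitely many linear equalities and inequalities. *)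

(* Defs.v *)
From HB Require Import structures.
From mathcomp Require Import all_boot all_order all_algebra.
From mathcomp Require Import boolp classical_sets reals constructive_ereal ereal.

Set Implicit Arguments.
Unset Strict Implicit.
Unset Printing Implicit Defensive.

Import Order.TTheory GRing.Theory Num.Theory.
Local Open Scope ring_scope.

(* Days are numbered from 0: [j : 'I_J] is day j+1. The half-days are
   [inl j] = first part of day j+1 and [inr k] = second part of day k, where
   k = 0 is the initial half-day and k = j+1 the second part of day j+1. *)
Definition time (J : nat) : finType := ('I_J + 'I_J.+1)%type.
Definition time0 J : time J := inr ord0.
Definition half1 J (j : 'I_J) : time J := inl j.
(* Indices of the second half-days just before and just after [half1 j]. *)
Definition half1_pred J (j : 'I_J) : 'I_J.+1 := widen_ord (leqnSn J) j.
Definition half1_succ J (j : 'I_J) : 'I_J.+1 := lift ord0 j.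

Definition half2 J (j : 'I_J) : time J := inr (half1_succ j).
Definition before J (j : 'I_J) : time J := inr (half1_pred j).

(* The arcs leaving at a first half-day, those leaving at a second half-day
   (including the initial one), and the parallel arcs (s:k) of the sources;
   in the first two, [inr d] stands for the pair (d, d). *)
Definition arc1 (S D : finType) (J : nat) : finType :=
  ((S * D + D) * 'I_J)%type.
Definition arc2 (S D : finType) (J : nat) : finType :=
  ((D * S + D) * 'I_J.+1)%type.
Definition arc3 (S : finType) (kappa : S -> nat) (J : nat) : finType :=
  ({s : S & 'I_(kappa s)} * time J)%type.
Definition arc (S D : finType) (kappa : S -> nat) (J : nat) : finType :=
  (arc1 S D J + arc2 S D J + arc3 kappa J)%type.

Definition arc_time S D kappa J (a : @arc S D kappa J) : time J :=
  match a with
  | inl (inl (_, j)) => inl j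
  | inl (inr (_, k)) => inr k
  | inr (_, i) => i
  end.

Definition arc_tail S D kappa J (a : @arc S D kappa J) : S + D :=
  match a with
  | inl (inl (inl (s, _), _)) => inl s
  | inl (inl (inr d, _)) => inr d
  | inl (inr (inl (d, _), _)) => inr d
  | inl (inr (inr d, _)) => inr d
  | inr (sk, _) => inl (tag sk)
  end.

Definition arc_head S D kappa J (a : @arc S D kappa J) : S + D :=
  match a with
  | inl (inl (inl (_, d), _)) => inr d
  | inl (inl (inr d, _)) => inr d
  | inl (inr (inl (_, s), _)) => inl s
  | inl (inr (inr d, _)) => inr d
  | inr (sk, _) => inl (tag sk)
  end.

Definition parallel S D kappa J (a : @arc S D kappa J) : bool :=
  if a is inr _ then true else false.

Definition init_arc (S D : finType) (kappa : S -> nat) (J : nat) : finType :=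
  {a : @arc S D kappa J | arc_time a == time0 J}.

Record data (R : realType) := Data {
  J : nat;
  J_gt0 : (0 < J)%N;
  src : finType;
  dst : finType;
  storage : finType;
  kappa : src -> nat;
  Xmax : R;
  rmax : src -> R;
  rmax_ge0 : forall s, 0 <= rmax s;
  h0 : 'I_24;
  g : src -> dst -> R;
  g_ge0 : forall s d, 0 <= g s d;
  demand : dst -> 'I_J -> 'I_24 -> R;
  demand_ge0 : forall d j h, 0 <= demand d j h;
  demand_le : forall d j, \sum_(h : 'I_24) demand d j h <= Xmax;
  transport : src + dst -> src + dst -> R;
  transport_ge0 : forall p1 p2, 0 <= transport p1 p2;
  transport_dd : forall d, transport (inr d) (inr d) = 0;
  c_tr : R;
  c_tr_ge0 : 0 <= c_tr;
  c_re : src -> R;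
  c_re_ge0 : forall s, 0 <= c_re s;
  c_v : R;
  c_v_ge0 : 0 <= c_v;
  c_f : R;
  c_f_ge0 : 0 <= c_f;
  y0 : init_arc dst kappa J -> bool;
  f0 : init_arc dst kappa J -> R;
  y0_sum : (\sum_a y0 a)%N = #|storage|
}.

Definition arcs R (P : data R) : finType := arc (dst P) (@kappa R P) (J P).

Definition arc_sd R (P : data R) (s : src P) (d : dst P) (j : 'I_(J P)) :
  arcs P := inl (inl (inl (s, d), j)).

(* The half-day [inr k]; (d, s) arcs exist at second half-days only. *)
Definition arc_ds R (P : data R) (d : dst P) (s : src P) (k : 'I_(J P).+1) :
  arcs P := inl (inr (inl (d, s), k)).

Definition arc_dd R (P : data R) (d : dst P) (i : time (J P)) : arcs P :=
  match i with
  | inl j => inl (inl (inr d, j))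
  | inr k => inl (inr (inr d, k))
  end.

Definition arc_s R (P : data R) (s : src P) (k : 'I_(kappa s))
    (i : time (J P)) : arcs P :=
  inr (Tagged (fun s => 'I_(kappa s)) k, i).

(* Cumulative demand up to and including hour h. *)
Definition cumul R (P : data R) (d : dst P) (j : 'I_(J P)) (h : 'I_24) : R :=
  \sum_(h' : 'I_24 | (h' <= h)%N) demand d j h'.

(* The slots of a source s: the first #|dst P| ones are the destinations
   d_l = enum_val l, the others are the parallel arcs of s. *)
Definition slot R (P : data R) (s : src P) : finType :=
  'I_(#|dst P| + kappa s).

Definition in_arc R (P : data R) (s : src P) (j : 'I_(J P)) (l : slot s) :
    arcs P :=
  match split l with
  | inl l' => arc_ds (enum_val l') s (half1_pred j)
  | inr k => arc_s k (before j)
  end.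

Definition out_arc R (P : data R) (s : src P) (j : 'I_(J P)) (l : slot s) :
    arcs P :=
  match split l with
  | inl l' => arc_sd s (enum_val l') j
  | inr k => arc_s k (half1 j)
  end.

(* In [z], [inl j] and [inr j] are the first and second part of day j+1. *)
Record solution R (P : data R) := Solution {
  y : arcs P -> bool;
  f : arcs P -> R;
  r : src P -> 'I_(J P) -> R;
  z : dst P -> 'I_(J P) + 'I_(J P) -> R;
  eta : dst P -> 'I_(J P) -> 'I_24;
  sigma : forall (s : src P) (j : 'I_(J P)),
    {l : slot s | y (in_arc j l)} -> {l : slot s | y (out_arc j l)}
}.

Definition demand1 R (P : data R) (x : solution P) d j : R :=
  \sum_(h : 'I_24) (eta x d j == h)%:R * cumul d j h.

Definition demand2 R (P : data R) (x : solution P) d j : R :=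
  cumul d j ord_max - demand1 x d j.

(* The number of sources serving d on day j. *)
Definition visits R (P : data R) (x : solution P) d j : nat :=
  (\sum_(s : src P) y x (arc_sd s d j))%N.

Record feasible R (P : data R) (x : solution P) : Prop := Feasible {
  f_range : forall a, 0 <= f x a <= Xmax P;
  z_range : forall d i, 0 <= z x d i <= Xmax P;
  r_ge0 : forall s j, 0 <= r x s j;
  y_init : forall a, y x (val a) = y0 a;
  f_init : forall a, f x (val a) = f0 a;
  C1 : forall a, 0 < f x a -> y x a;
  C2 : forall d i, y x (arc_dd d i);
  C3 : forall d j,
    f x (arc_dd d (half1 j)) = f x (arc_dd d (before j)) - z x d (inl j);
  C5 : forall d j,
    z x d (inl j) = Num.min (f x (arc_dd d (before j))) (demand1 x d j);
  C6 : forall d j, (visits x d j <= 1)%N;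
  C7 : forall d j,
    visits x d j = (\sum_(s : src P) y x (arc_ds d s (half1_succ j)))%N;
  C8 : forall d j,
    f x (arc_dd d (half1 j)) =
      (visits x d j == 0%N)%:R * f x (arc_dd d (half1 j))
      + \sum_(s : src P) f x (arc_ds d s (half1_succ j));
  C9 : forall d j,
    f x (arc_dd d (half2 j)) =
      \sum_(s : src P) f x (arc_sd s d j)
      + (visits x d j == 0%N)%:R * f x (arc_dd d (half1 j))
      - z x d (inr j);
  C10 : forall s d j, y x (arc_sd s d j) ->
    (eta x d j)%:R = (h0 P)%:R + g s d;
  C11 : forall d j, visits x d j = 0%N -> eta x d j = 12 :> nat;
  C13 : forall d j,
    z x d (inr j) = Num.min (f x (arc_dd d (half1 j))) (demand2 x d j);
  C14 : forall s j,
    (\sum_(d : dst P) y x (arc_ds d s (half1_pred j))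
     + \sum_(k < kappa s) y x (arc_s k (before j)) <= kappa s)%N;
  C15 : forall s j,
    (\sum_(d : dst P) y x (arc_ds d s (half1_pred j))
     + \sum_(k < kappa s) y x (arc_s k (before j)))%N =
    (\sum_(d : dst P) y x (arc_sd s d j)
     + \sum_(k < kappa s) y x (arc_s k (half1 j)))%N;
  C16 : forall s j,
    \sum_(d : dst P) f x (arc_ds d s (half1_pred j))
    + \sum_(k < kappa s) f x (arc_s k (before j)) + r x s j =
    \sum_(d : dst P) f x (arc_sd s d j)
    + \sum_(k < kappa s) f x (arc_s k (half1 j));
  C17 : forall s j, r x s j <= rmax s;
  C18_bij : forall s j, bijective (@sigma R P x s j);
  C18_le : forall s j (l : {l : slot s | y x (in_arc j l)}),
    f x (in_arc j (val l)) <= f x (out_arc j (val (sigma l)));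
  C19 : forall s j (k k' : 'I_(kappa s)), k' = k.+1 :> nat ->
    y x (arc_s k' (half1 j)) -> y x (arc_s k (half1 j));
  C20_f : forall s j (k : 'I_(kappa s)),
    f x (arc_s k (half1 j)) = f x (arc_s k (half2 j));
  C20_y : forall s j (k : 'I_(kappa s)),
    y x (arc_s k (half1 j)) = y x (arc_s k (half2 j))
}.

Definition shortage R (P : data R) (x : solution P) d j : R :=
  demand1 x d j + demand2 x d j - (z x d (inl j) + z x d (inr j)).

Definition objective R (P : data R) (x : solution P) : R :=
  c_tr P * (\sum_(a : arcs P | ~~ parallel a)
              transport (arc_tail a) (arc_head a) * (y x a)%:R)
  + \sum_(s : src P) \sum_(j < J P) c_re s * r x s j
  + c_v P * (\sum_(d : dst P) \sum_(j < J P) shortage x d j)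
  + c_f P * (\sum_(d : dst P) \sum_(j < J P) (0 < shortage x d j)%R%:R).

(* The scalar variables of the problem, in the order y, f, r, z, eta, sigma;
   the bijection sigma_{s,j} is represented by its graph, i.e. by the 0/1
   variables [sigma_{s,j}(l) = l'] for slots l and l' of s. *)
Definition pvar R (P : data R) : finType :=
  (arcs P + arcs P + src P * 'I_(J P) + dst P * ('I_(J P) + 'I_(J P))
   + dst P * 'I_(J P) + {s : src P & 'I_(J P) * (slot s * slot s)})%type.

Definition sigma_graph R (P : data R) (x : solution P) (s : src P)
    (j : 'I_(J P)) (l l' : slot s) : bool :=
  [exists u : {l : slot s | y x (in_arc j l)},
     (val u == l) && (val (sigma u) == l')].

Definition coordinate R (P : data R) (x : solution P) (v : pvar P) : R :=
  match v with
  | inl (inl (inl (inl (inl a)))) => (y x a)%:R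
  | inl (inl (inl (inl (inr a)))) => f x a
  | inl (inl (inl (inr (s, j)))) => r x s j
  | inl (inl (inr (d, i))) => z x d i
  | inl (inr (d, j)) => (eta x d j)%:R
  | inr (existT s (j, (l, l'))) => (sigma_graph x j l l')%:R
  end.

(* Mixed-integer linear programs in the variables V; a row (a, b) stands for
   the constraint \sum_v a v * x v <= b, resp. = b. *)
Record milp (R : realType) (V : finType) := Milp {
  milp_int : {set V};
  milp_cost : V -> R;
  milp_le : seq ((V -> R) * R);
  milp_eq : seq ((V -> R) * R)
}.

Definition linform (R : realType) (V : finType) (a x : V -> R) : R :=
  \sum_(v : V) a v * x v.

Definition milp_objective R V (M : milp R V) (x : V -> R) : R :=
  linform (milp_cost M) x.

Definition milp_feasible R V (M : milp R V) (x : V -> R) : Prop :=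
  [/\ forall v, v \in milp_int M -> x v \is a Num.int,
      all (fun c => linform c.1 x <= c.2) (milp_le M)
    & all (fun c => linform c.1 x == c.2) (milp_eq M)].

Definition is_optimal (R : realType) (T : Type) (F : T -> Prop) (c : T -> R)
    (x : T) : Prop :=
  F x /\ forall x', F x' -> c x <= c x'.

(* The infimum in the extended reals: +oo for an infeasible problem. *)
Definition optimal_value (R : realType) (T : Type) (F : T -> Prop)
    (c : T -> R) : \bar R :=
  ereal_inf (image [set x | F x]%classic (fun x => (c x)%:E)).

(* x is a point of the program whose values at the variables of the problem
   are those of p (this determines p); the other variables are auxiliary. *)
Definition represents R (P : data R) (V : finType) (x : pvar P + V -> R)
    (p : solution P) : Prop :=
  forall v : pvar P, x (inl v) = coordinate p v.

(* Main.v *)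
Require Import Defs.
From mathcomp Require Import all_boot all_order all_algebra.
From mathcomp Require Import boolp classical_sets reals constructive_ereal ereal.

Set Implicit Arguments.
Unset Strict Implicit.
Unset Printing Implicit Defensive.

Import Order.TTheory GRing.Theory Num.Theory.
Local Open Scope ring_scope.

(** Over the box where each variable lies between zero and its bound and the
variables y, eta and sigma are integers, every nonlinear constraint of the
problem is a finite combination, by conjunctions and disjunctions, of linear
inequalities:
- an implication whose premise is a binary variable y is the disjunction of
  y <= 0 and of its conclusion, and an indicator of the number of visits,
  which is 0 or 1, is a case distinction of the same kind;
- z = min(a, b) says that z <= a, z <= b, and a <= z or b <= z;
- a constraint whose coefficients depend on the integer eta says that, for
  each hour h, eta <= h - 1, or eta >= h + 1, or the constraint holds with h
  in place of eta;
- a bijection sigma is given by its graph, a 0/1 matrix with prescribed row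
  and column sums.
[cnf_rules] collects these descriptions; [feasible_rules], [rules_feasible]
and [decode] show that they define exactly the feasible points.

A combination of linear inequalities has a conjunctive normal form, and
[milp_of_cnf] compiles such a form into a mixed-integer linear program: each
literal a(x) <= b gets a binary selector t and the row a(x) <= b + M (1 - t),
and each clause asks that one of its selectors be 1. A finite M exists because
the box is bounded.

In the objective, the fixed cost of a shortage is carried by a charge q in
[0, 1] such that the shortage is nonpositive or q >= 1. As the unit cost is
nonnegative, the cost of a point of the program is at least the objective of
the solution that it represents ([feasible_charged]), with equality when q is
the indicator of a positive shortage ([charge_feasible]). These two facts
suffice to identify optimal values and optimal points ([optima_transfer]). *)

(** * Affine functions *)

Definition affine (R : realType) (V : finType) (a : (V -> R) -> R) : Prop :=
  exists (c : V -> R) (k : R), forall x, a x = linform c x + k.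

Lemma affine_const (R : realType) (V : finType) (k : R) :
  affine (fun _ : V -> R => k).
Proof.
exists (fun=> 0), k => x.
by rewrite /linform big1 ?add0r // => v _; rewrite mul0r.
Qed.

Lemma affine_var (R : realType) (V : finType) (v : V) :
  affine (fun x : V -> R => x v).
Proof.
exists (fun u => (u == v)%:R), 0 => x.
rewrite /linform addr0 (bigD1 v) //= eqxx mul1r big1 ?addr0 // => u /negbTE->.
by rewrite mul0r.
Qed.

Lemma affineD (R : realType) (V : finType) (a b : (V -> R) -> R) :
  affine a -> affine b -> affine (fun x => a x + b x).
Proof.
move=> [c [k Ha]] [d [l Hb]]; exists (fun v => c v + d v), (k + l) => x.
rewrite Ha Hb addrACA /linform -big_split /=.
by congr (_ + _); apply: eq_bigr => v _; rewrite mulrDl.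
Qed.

Lemma affineZ (R : realType) (V : finType) (t : R) (a : (V -> R) -> R) :
  affine a -> affine (fun x => t * a x).
Proof.
move=> [c [k Ha]]; exists (fun v => t * c v), (t * k) => x.
rewrite Ha mulrDr /linform mulr_sumr.
by congr (_ + _); apply: eq_bigr => v _; rewrite mulrA.
Qed.

Lemma affineN (R : realType) (V : finType) (a : (V -> R) -> R) :
  affine a -> affine (fun x => - a x).
Proof.
move=> /(affineZ (-1)) [c [k Ha]]; exists c, k => x.
by rewrite -Ha mulN1r.
Qed.

Lemma affine_sum (R : realType) (V : finType) (I : Type) (s : seq I)
    (P : pred I) (a : I -> (V -> R) -> R) :
  (forall i, affine (a i)) -> affine (fun x => \sum_(i <- s | P i) a i x).
Proof.
move=> Ha; elim: s => [|i s [c [k IH]]].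
  have [c [k H0]] := @affine_const R V 0.
  by exists c, k => x; rewrite big_nil -H0.
have [d [l Hi]] : affine (fun x => (if P i then a i x else 0)
                                   + \sum_(j <- s | P j) a j x).
  by apply: affineD; [case: (P i) => //; exact: affine_const | exists c, k].
by exists d, l => x; rewrite -Hi big_cons; case: (P i); rewrite ?add0r.
Qed.

Ltac affine := repeat first
  [ exact: affine_var | exact: affine_const | apply: affineD | apply: affineN
  | apply: affineZ | apply: affine_sum => ? ].

Definition holds (R : realType) (V : finType) (x : V -> R)
    (c : (V -> R) * R) : bool := linform c.1 x <= c.2.

Lemma affine_holds (R : realType) (V : finType) (a b : (V -> R) -> R) :
  affine a -> affine b -> exists c, forall x, (a x <= b x) = holds x c.
Proof.
move=> Ha Hb; have [c [k H]] := affineD Ha (affineN Hb).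
by exists (c, - k) => x; rewrite /holds /= -subr_le0 H -lerBrDr sub0r.
Qed.

(** * Systems of linear rows *)

Lemma all_flatten_enum (I : finType) (T : Type) (p : pred T) (r : I -> seq T) :
  all p (flatten [seq r i | i <- enum I]) = [forall i, all p (r i)].
Proof.
have E ss : all p (flatten ss) = all (all p) ss.
  by elim: ss => //= s ss <-; rewrite all_cat.
rewrite E all_map; apply/allP/forallP => H i; last by move=> _; apply: H.
by apply: H; rewrite mem_enum.
Qed.

Definition rows (R : realType) (V : finType) (Q : (V -> R) -> bool) : Prop :=
  exists rs, forall x, Q x = all (holds x) rs.

Lemma rows_le (R : realType) (V : finType) (a b : (V -> R) -> R) :
  affine a -> affine b -> rows (fun x => a x <= b x).
Proof.
move=> Ha Hb; have [c Hc] := affine_holds Ha Hb.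
by exists [:: c] => x; rewrite Hc /= andbT.
Qed.

Lemma rows_and (R : realType) (V : finType) (Q1 Q2 : (V -> R) -> bool) :
  rows Q1 -> rows Q2 -> rows (fun x => Q1 x && Q2 x).
Proof. by move=> [r H] [s K]; exists (r ++ s) => x; rewrite all_cat H K. Qed.

Lemma rows_forall (R : realType) (V I : finType) (Q : I -> (V -> R) -> bool) :
  (forall i, rows (Q i)) -> rows (fun x => [forall i, Q i x]).
Proof.
move=> H; pose r i := sval (cid (H i)).
exists (flatten [seq r i | i <- enum I]) => x; rewrite all_flatten_enum.
by apply: eq_forallb => i; rewrite (svalP (cid (H i))).
Qed.

(** * Conjunctive normal forms of linear inequalities *)

(** The outer list is the conjunction, the inner lists are the clauses. *)
Definition cnf (R : realType) (V : finType) (Q : (V -> R) -> bool) : Prop :=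
  exists cl : seq (seq ((V -> R) * R)), forall x, Q x = all (has (holds x)) cl.

Lemma cnf_true (R : realType) (V : finType) : cnf (fun _ : V -> R => true).
Proof. by exists [::]. Qed.

Lemma cnf_le (R : realType) (V : finType) (a b : (V -> R) -> R) :
  affine a -> affine b -> cnf (fun x => a x <= b x).
Proof.
move=> Ha Hb; have [c Hc] := affine_holds Ha Hb.
by exists [:: [:: c]] => x; rewrite Hc /= andbT orbF.
Qed.

Lemma cnf_and (R : realType) (V : finType) (Q1 Q2 : (V -> R) -> bool) :
  cnf Q1 -> cnf Q2 -> cnf (fun x => Q1 x && Q2 x).
Proof. by move=> [r H] [s K]; exists (r ++ s) => x; rewrite all_cat H K. Qed.

(** Disjunction distributes over the two conjunctions. *)
Lemma cnf_or (R : realType) (V : finType) (Q1 Q2 : (V -> R) -> bool) :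
  cnf Q1 -> cnf Q2 -> cnf (fun x => Q1 x || Q2 x).
Proof.
move=> [r H] [s K]; exists [seq c ++ d | c <- r, d <- s] => x.
rewrite {}H {}K; elim: r => //= c r IH.
rewrite all_cat -IH all_map orb_andl; congr andb.
have -> : all (preim (cat c) (has (holds x))) s
          = all (fun d => has (holds x) c || has (holds x) d) s.
  by apply: eq_all => d /=; rewrite has_cat.
by elim: s {IH} => [|d s IHs] /=; [rewrite orbT | rewrite orb_andr IHs].
Qed.

Lemma cnf_forall (R : realType) (V I : finType) (Q : I -> (V -> R) -> bool) :
  (forall i, cnf (Q i)) -> cnf (fun x => [forall i, Q i x]).
Proof.
move=> H; pose r i := sval (cid (H i)).
exists (flatten [seq r i | i <- enum I]) => x; rewrite all_flatten_enum.
by apply: eq_forallb => i; rewrite (svalP (cid (H i))).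
Qed.

Lemma cnf_eq (R : realType) (V : finType) (a b : (V -> R) -> R) :
  affine a -> affine b -> cnf (fun x => a x == b x).
Proof.
move=> Ha Hb; have [cl H] := cnf_and (cnf_le Ha Hb) (cnf_le Hb Ha).
by exists cl => x; rewrite eq_le H.
Qed.

Lemma cnf_min (R : realType) (V : finType) (z a b : (V -> R) -> R) :
  affine z -> affine a -> affine b ->
  cnf (fun x => z x == Num.min (a x) (b x)).
Proof.
move=> Hz Ha Hb.
have [cl H] := cnf_and (cnf_and (cnf_le Hz Ha) (cnf_le Hz Hb))
                       (cnf_or (cnf_le Ha Hz) (cnf_le Hb Hz)).
by exists cl => x; rewrite eq_le le_min ge_min H.
Qed.

Lemma cnf_imply (R : realType) (V : finType) (b : bool)
    (Q : (V -> R) -> bool) :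
  cnf Q -> cnf (fun x => b ==> Q x).
Proof. by case: b => //= _; exact: cnf_true. Qed.

Ltac cnf := repeat first
  [ apply: cnf_imply | apply: cnf_min | apply: cnf_eq | apply: cnf_le
  | apply: cnf_and | apply: cnf_or | apply: cnf_forall => ? ]; affine.

(** A clause may be padded with the unsatisfiable literal 0 <= -1, so that all
clauses get the same length and the literals are indexed by a product. *)
Lemma cnf_rect (R : realType) (V : finType) (Q : (V -> R) -> bool) :
  cnf Q -> exists m N (c : 'I_m -> 'I_N -> (V -> R) * R),
    forall x, Q x = [forall i, exists k, holds x (c i k)].
Proof.
move=> [cl H]; pose F : (V -> R) * R := (fun=> 0, -1).
have F0 x : holds x F = false.
  rewrite /holds /linform big1 => [|v _]; last by rewrite mul0r.
  by rewrite lerNr oppr0 ler10.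
pose N := (\max_(i < size cl) size (nth [::] cl i))%N.
exists (size cl), N, (fun i k => nth F (nth [::] cl i) k) => x; rewrite H.
apply/(all_nthP [::])/forallP => K i; last first.
  move=> i_lt; have /existsP[k Hk] := K (Ordinal i_lt); apply/(has_nthP F).
  exists k => //; rewrite ltnNge; apply: contraTN Hk => /= k_ge.
  by rewrite nth_default ?F0.
have /(has_nthP F)[k k_lt Hk] := K _ (ltn_ord i).
have kN : (k < N)%N by apply: leq_trans k_lt (leq_bigmax i).
by apply/existsP; exists (Ordinal kN).
Qed.

(** * Compilation of a normal form over a box *)

Definition box (R : realType) (V : finType) (hi : V -> R) (int : pred V)
    (x : V -> R) : bool :=
  [forall v, (0 <= x v <= hi v) && (int v ==> (x v \is a Num.int))].

(** The right-hand side depends on the box only: it provides the constants by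
which a deselected literal is relaxed. *)
Lemma box_bound (R : realType) (V : finType) (hi : V -> R) (int : pred V)
    (c : V -> R) (x : V -> R) :
  box hi int x -> linform c x <= \sum_v `|c v| * `|hi v|.
Proof.
move=> /forallP Hx; apply: ler_sum => v _.
have /andP[/andP[x0 xh] _] := Hx v.
apply: le_trans (ler_norm _) _; rewrite normrM ler_wpM2l //.
by rewrite !ger0_norm // (le_trans x0).
Qed.

Lemma int01 (R : realType) (t : R) :
  0 <= t <= 1 -> t \is a Num.int -> t = (t == 1)%:R.
Proof.
move=> /andP[t0 t1]; rewrite intrEge0 // => /natrP[n tn].
move: t1; rewrite {}tn (ler_nat _ n 1) pnatr_eq1.
by case: n => [|[|]].
Qed.

Section Compile.

Context (R : realType) (U K : finType) (hi : U + K -> R) (int : pred (U + K)).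
Context (m N : nat) (cl : 'I_m -> 'I_N -> (U + K -> R) * R).

(* The auxiliary variables are those of K, one selector for each literal and a
   variable fixed to 1, which carries the constant term of the cost. *)
Let aux : finType := (K + option ('I_m * 'I_N))%type.

Let emb (w : U + K + option ('I_m * 'I_N)) : U + 'I_#|{: aux}| :=
  match w with
  | inl (inl u) => inl u
  | inl (inr k) => inr (enum_rank (inl k : aux))
  | inr q => inr (enum_rank (inr q : aux))
  end.

Let proj (v : U + 'I_#|{: aux}|) : U + K + option ('I_m * 'I_N) :=
  match v with
  | inl u => inl (inl u)
  | inr i => match enum_val i with inl k => inl (inr k) | inr q => inr q end
  end.

Let embK : cancel emb proj.
Proof. by case=> [[u|k]|q] //=; rewrite enum_rankK. Qed.

Let projK : cancel proj emb.
Proof.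
case=> [u //|i] /=; rewrite -[in RHS](enum_valK i).
by case: (enum_val i).
Qed.

Let bigM i k : R := \sum_v `|(cl i k).1 v| * `|hi v| - (cl i k).2.

Let val_of (x : U + 'I_#|{: aux}| -> R) (v : U + K) : R := x (emb (inl v)).
Let sel (x : U + 'I_#|{: aux}| -> R) (q : 'I_m * 'I_N) : R :=
  x (emb (inr (Some q))).

(* The literal (i, k) is imposed when its selector is 1, and implied by the
   box when it is 0. *)
Let relaxation (x : U + 'I_#|{: aux}| -> R) : bool :=
  [&& [forall v, (0 <= val_of x v) && (val_of x v <= hi v)],
      [forall q, (0 <= sel x q) && (sel x q <= 1)],
      [forall i, forall k, linform (cl i k).1 (val_of x) <=
         (cl i k).2 + bigM i k * (1 - sel x (i, k))],
      [forall i, 1 <= \sum_k sel x (i, k)],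
      x (emb (inr None)) <= 1
    & 1 <= x (emb (inr None))].

Let integer : {set U + 'I_#|{: aux}|} :=
  [set v | match proj v with
           | inl w => int w | inr (Some _) => true | inr None => false end].

Let rows_relaxation : rows relaxation.
Proof.
rewrite /relaxation /val_of /sel /linform.
repeat first [apply: rows_and | apply: rows_forall => ? | apply: rows_le];
  affine.
Qed.


(** From a point of the box satisfying the normal form, take as selectors the
truth values of the literals. Conversely, selectors are binary with sum at
least 1 in each clause, so that each clause has a selected, hence true,
literal. *)
Lemma milp_of_rect (a : (U + K -> R) -> R) : affine a ->
  let ok w := box hi int w && [forall i, exists k, holds w (cl i k)] in
  exists n (M : milp R (U + 'I_n)%type),
    (forall w, ok w -> exists x, [/\ milp_feasible M x,
       forall u, x (inl u) = w (inl u) & milp_objective M x = a w]) /\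
    (forall x, milp_feasible M x -> exists w, [/\ ok w,
       forall u, w (inl u) = x (inl u) & milp_objective M x = a w]).
Proof.
move=> [c [k0 Ha]] ok; have [rs Hrs] := rows_relaxation.
pose cost v := match proj v with
  | inl w => c w | inr None => k0 | inr (Some _) => 0 end.
exists _, (Milp integer cost rs [::]).
have costE x : x (emb (inr None)) = 1 -> linform cost x = a (val_of x).
  move=> x1; rewrite Ha /linform (reindex emb); last first.
    by exists proj => v _; [exact: embK | exact: projK].
  have costw w : cost (emb w) = match w with
    | inl w => c w | inr None => k0 | inr (Some _) => 0 end.
    by rewrite /cost embK.
  rewrite big_sumType; congr (_ + _).
    by apply: eq_bigr => v _; rewrite costw.
  rewrite (bigD1 None) // costw x1 mulr1 big1; first exact: addr0.
  by case=> [q|//] _; rewrite costw mul0r.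
have feasE x : milp_feasible (Milp integer cost rs [::]) x <->
    (forall w, emb w \in integer -> x (emb w) \is a Num.int) /\ relaxation x.
  rewrite Hrs; split=> [[/= Hi Hr _]|[Hi Hr]]; split=> //.
    by move=> w; apply: Hi.
  by move=> v; rewrite -(projK v); apply: Hi.
split=> [w /andP[Bw /forallP Cw] | x /feasE[intx]].
  pose xi v := match v with
    | inl v => w v
    | inr None => 1
    | inr (Some (i, k)) => (holds w (cl i k))%:R end.
  pose x := xi \o proj.
  have xE v : x (emb v) = xi v by rewrite /x /= embK.
  have valE : val_of x = w by apply/funext => v; rewrite /val_of xE.
  have selE i k : sel x (i, k) = (holds w (cl i k))%:R by rewrite /sel xE.
  exists x; split=> //; last by rewrite /milp_objective /= costE ?valE ?xE.
  apply/feasE; split.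
    move=> [v|[[i k]|]]; rewrite xE inE embK //= => int_v.
    by have /forallP/(_ v)/andP[_ /implyP->] := Bw.
  apply/and5P; split.
  - by apply/forallP => v; rewrite valE; have /forallP/(_ v)/andP[] := Bw.
  - by apply/forallP => -[i k]; rewrite selE ler0n lern1 leq_b1.
  - apply/forallP => i; apply/forallP => k; rewrite valE selE.
    have [Hh|_] := boolP (holds w (cl i k)); first by rewrite subrr mulr0 addr0.
    by rewrite subr0 mulr1 addrC subrK; apply: box_bound Bw.
  - apply/forallP => i; have /existsP[k Hk] := Cw i.
    rewrite (bigD1 k) //= selE Hk lerDl sumr_ge0 // => l _.
    by rewrite selE ler0n.
  by rewrite xE lexx.
case/and5P=> /forallP Bx /forallP Sx /forallP Lx /forallP Dx /andP[one1 one2].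
have one_x : x (emb (inr None)) = 1 by apply: le_anti; rewrite one1.
exists (val_of x); split=> //; last exact: costE.
have intE w : emb w \in integer = match w with
    | inl w => int w | inr (Some _) => true | inr None => false end.
  by rewrite inE embK.
apply/andP; split; apply/forallP; last move=> i.
  by move=> v; rewrite Bx; apply/implyP => v_int; apply: intx; rewrite intE.
have selE k : sel x (i, k) = (sel x (i, k) == 1)%:R.
  by apply: int01 => //; apply: intx; rewrite intE.
have [/existsP[k /eqP sel1]|] := boolP [exists k, sel x (i, k) == 1].
  apply/existsP; exists k; have /forallP/(_ k) := Lx i.
  by rewrite sel1 subrr mulr0 addr0.
rewrite negb_exists => /forallP sel0; have := Dx i.
by rewrite big1 ?ler10 // => k _; rewrite selE (negbTE (sel0 k)).
Qed.

End Compile.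

Lemma milp_of_cnf (R : realType) (U K : finType) (hi : U + K -> R)
    (int : pred (U + K)) (Q : (U + K -> R) -> bool) (a : (U + K -> R) -> R) :
  cnf Q -> affine a ->
  exists n (M : milp R (U + 'I_n)%type),
    (forall w, box hi int w -> Q w -> exists x, [/\ milp_feasible M x,
       forall u, x (inl u) = w (inl u) & milp_objective M x = a w]) /\
    (forall x, milp_feasible M x -> exists w, [/\ box hi int w, Q w,
       forall u, w (inl u) = x (inl u) & milp_objective M x = a w]).
Proof.
move=> /cnf_rect[m [N [cl HQ]]] Ha.
have [n [M [H1 H2]]] := milp_of_rect hi int cl Ha.
exists n, M; split=> [w Bw Qw | x /H2[w [/andP[Bw Qw] Ew Ow]]].
  by apply: H1; rewrite Bw -HQ.
by exists w; rewrite HQ.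
Qed.

(** * Transfer of optima *)

(** The cost of x may exceed that of the p it represents: if x is optimal, it
cannot, since p is also represented at its exact cost. *)
Lemma optima_transfer (R : realType) (T X : Type) (F : T -> Prop) (c : T -> R)
    (G : X -> Prop) (e : X -> R) (rep : X -> T -> Prop) :
  (forall p, F p -> exists x, [/\ G x, rep x p & e x = c p]) ->
  (forall x, G x -> exists p, [/\ F p, rep x p & c p <= e x]) ->
  [/\ optimal_value F c = optimal_value G e,
      forall p, is_optimal F c p -> exists x, is_optimal G e x /\ rep x p
    & forall x, is_optimal G e x -> exists p, is_optimal F c p /\ rep x p].
Proof.
move=> FG GF; split.
- apply: le_anti; apply/andP; split; apply: le_ereal_inf_tmp.
    move=> _ [x Gx <-]; have [p [Fp _ le_px]] := GF x Gx.
    by apply: ge_ereal_inf; exists (c p)%:E; [exists p | rewrite lee_fin].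
  move=> _ [p Fp <-]; have [x [Gx _ <-]] := FG p Fp.
  by apply: ge_ereal_inf; exists (e x)%:E; first by exists x.
- move=> p [Fp min_p]; have [x [Gx rep_xp xp]] := FG p Fp.
  exists x; split=> //; split=> // x' /GF[p' [Fp' _ le_p'x']].
  by rewrite xp (le_trans (min_p p' Fp')).
- move=> x [Gx min_x]; have [p [Fp rep_xp le_px]] := GF x Gx.
  exists p; split=> //; split=> // p' /FG[x' [Gx' _ <-]].
  by rewrite (le_trans le_px) ?min_x.
Qed.

(** * Bijections as 0/1 matrices *)

(** Row sums make the matrix g the graph of a function from A to B, column sums
give the function in the other direction, and uniqueness of the 1 in a row or
a column makes them inverse to each other. *)
Lemma graph_bijection (T : finType) (A B : pred T) (g : T -> T -> bool) :
  (forall l, (\sum_l' g l l')%N = A l) ->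
  (forall l', (\sum_l g l l')%N = B l') ->
  exists2 sg : {l | A l} -> {l | B l}, bijective sg &
    forall l l', [exists u, (val u == l) && (val (sg u) == l')] = g l l'.
Proof.
have uniq1 (h : pred T) (b : bool) a a' :
    (\sum_l h l)%N = b -> h a -> h a' -> a = a'.
  move=> sum_h ha ha'; apply/eqP; apply: contraT => neq.
  have : (\sum_l h l <= 1)%N by rewrite sum_h leq_b1.
  by rewrite (bigD1 a) //= (bigD1 a') 1?eq_sym //= ha ha'.
have ex1 (h : pred T) (b : bool) : (\sum_l h l)%N = b -> b -> exists l, h l.
  move=> sum_h b1; apply/existsP; apply: contraT.
  rewrite negb_exists => /forallP h0.
  by move: sum_h; rewrite b1 big1 // => l _; rewrite (negbTE (h0 l)).
have in1 (h : pred T) (b : bool) a : (\sum_l h l)%N = b -> h a -> b.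
  by case: b => //; rewrite (bigD1 a) //= => + ha; rewrite ha.
move=> rowg colg.
have gB l l' : g l l' -> B l' by apply: in1 (colg l').
have gA l l' : g l l' -> A l by apply: in1 (rowg l).
have out (u : {l | A l}) : exists w : {l | B l}, g (val u) (val w).
  have [l' gl'] := ex1 _ _ (rowg (val u)) (valP u).
  by exists (Sub l' (gB _ _ gl')).
have inn (w : {l | B l}) : exists u : {l | A l}, g (val u) (val w).
  have [l gl] := ex1 _ _ (colg (val w)) (valP w).
  by exists (Sub l (gA _ _ gl)).
pose sg u := sval (cid (out u)); pose tg w := sval (cid (inn w)).
have gsg u : g (val u) (val (sg u)) := svalP (cid (out u)).
have gtg w : g (val (tg w)) (val w) := svalP (cid (inn w)).
exists sg.
  exists tg => [u | w]; apply: val_inj.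
    exact: uniq1 (colg (val (sg u))) _ _.
  exact: uniq1 (rowg (val (tg w))) _ _.
move=> l l'; apply/existsP/idP => [[u /andP[/eqP<- /eqP<-]] //|gll'].
exists (Sub l (gA _ _ gll')); rewrite SubK eqxx /=; apply/eqP.
apply: (uniq1 _ _ _ _ (rowg l)) => //.
by have := gsg (Sub l (gA _ _ gll')); rewrite SubK.
Qed.

Lemma bijection_graph (T : finType) (A B : pred T)
    (sg : {l | A l} -> {l | B l}) :
  let g l l' := [exists u, (val u == l) && (val (sg u) == l')] in
  (forall l, (\sum_l' g l l')%N = A l) /\
  (bijective sg -> forall l', (\sum_l g l l')%N = B l').
Proof.
move=> g; split=> [l | [tg sgK tgK] l'].
  have [Al|nAl] := boolP (A l); last first.
    rewrite big1 // => l' _; rewrite [g _ _](_ : _ = false) //.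
    by apply/existsP => -[u /andP[/eqP ul _]]; rewrite -ul (valP u) in nAl.
  pose u : {l | A l} := Sub l Al.
  rewrite (bigD1 (val (sg u))) //= big1 => [|l' ne]; last first.
    rewrite [g _ _](_ : _ = false) //; apply/existsP => -[w /andP[wl /eqP wl']].
    have wu : w = u by apply: val_inj; rewrite (eqP wl).
    by rewrite -wl' wu eqxx in ne.
  rewrite [g _ _](_ : _ = true) //; apply/existsP; exists u.
  by rewrite SubK !eqxx.
have [Bl|nBl] := boolP (B l'); last first.
  rewrite big1 // => l _; rewrite [g _ _](_ : _ = false) //.
  by apply/existsP => -[u /andP[_ /eqP ul]]; rewrite -ul (valP (sg u)) in nBl.
pose w : {l | B l} := Sub l' Bl.
rewrite (bigD1 (val (tg w))) //= big1 => [|l ne]; last first.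
  rewrite [g _ _](_ : _ = false) //.
  apply/existsP => -[u /andP[/eqP ul /eqP sgu]].
  have uw : sg u = w by apply: val_inj; rewrite sgu.
  by rewrite -ul -(sgK u) uw eqxx in ne.
rewrite [g _ _](_ : _ = true) //; apply/existsP; exists (tg w).
by rewrite tgK SubK !eqxx.
Qed.

(** * The constraints as combinations of linear inequalities *)

Section Model.

Context (R : realType) (P : data R).
Implicit Types (u : pvar P -> R) (p : solution P).
Implicit Types (s : src P) (d : dst P) (j : 'I_(J P)).

Definition yvar (a : arcs P) : pvar P := inl (inl (inl (inl (inl a)))).
Definition fvar (a : arcs P) : pvar P := inl (inl (inl (inl (inr a)))).
Definition rvar s j : pvar P := inl (inl (inl (inr (s, j)))).
Definition zvar d (i : 'I_(J P) + 'I_(J P)) : pvar P := inl (inl (inr (d, i))).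
Definition etavar d j : pvar P := inl (inr (d, j)).
Definition sigmavar s j (l l' : slot s) : pvar P :=
  inr (existT (fun s => 'I_(J P) * (slot s * slot s))%type s (j, (l, l'))).

Definition var_max (v : pvar P) : R :=
  match v with
  | inl (inl (inl (inl (inl _)))) => 1
  | inl (inl (inl (inl (inr _)))) => Xmax P
  | inl (inl (inl (inr (s, _)))) => rmax s
  | inl (inl (inr _)) => Xmax P
  | inl (inr _) => 23
  | inr _ => 1
  end.

Definition var_int (v : pvar P) : bool :=
  match v with
  | inl (inl (inl (inl (inl _)))) | inl (inr _) | inr _ => true
  | _ => false
  end.

Definition arc_rules u : bool :=
  [&& [forall a, (u (fvar a) <= 0) || (1 <= u (yvar a))],
      [forall a : init_arc (dst P) (@kappa R P) (J P),
                 (u (yvar (val a)) == (y0 a)%:R)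
                 && (u (fvar (val a)) == f0 a)]
    & [forall d, forall i, u (yvar (arc_dd d i)) == 1]].

(** The hour eta is an integer: for each h, it is at most h - 1, at least h + 1,
or equal to h; only in the last case is the demand before the swap the
cumulative demand at h. *)
Definition demand_rules u : bool :=
  [forall d, forall j,
     (u (fvar (arc_dd d (half1 j))) ==
        u (fvar (arc_dd d (before j))) - u (zvar d (inl j)))
     && [forall h : 'I_24,
           [|| u (etavar d j) + 1 <= h%:R, h%:R + 1 <= u (etavar d j)
             | (u (zvar d (inl j)) ==
                  Num.min (u (fvar (arc_dd d (before j)))) (cumul d j h))
               && (u (zvar d (inr j)) ==
                     Num.min (u (fvar (arc_dd d (half1 j))))
                             (cumul d j ord_max - cumul d j h))]]].

Definition visit_sum u d j : R := \sum_(s : src P) u (yvar (arc_sd s d j)).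

(** The number of visits is 0 or 1, and each of the two cases is imposed as an
alternative to the other one. *)
Definition visit_rules u : bool :=
  [forall d, forall j,
     [&& visit_sum u d j <= 1,
         visit_sum u d j ==
           \sum_(s : src P) u (yvar (arc_ds d s (half1_succ j))),
         (1 <= visit_sum u d j) ||
           [&& 0 == \sum_(s : src P) u (fvar (arc_ds d s (half1_succ j))),
               u (fvar (arc_dd d (half2 j))) ==
                 \sum_(s : src P) u (fvar (arc_sd s d j))
                 + u (fvar (arc_dd d (half1 j))) - u (zvar d (inr j))
             & u (etavar d j) == 12],
         (visit_sum u d j <= 0) ||
           (u (fvar (arc_dd d (half1 j))) ==
              \sum_(s : src P) u (fvar (arc_ds d s (half1_succ j))))
           && (u (fvar (arc_dd d (half2 j))) ==
                 \sum_(s : src P) u (fvar (arc_sd s d j)) - u (zvar d (inr j)))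
       & [forall s, (u (yvar (arc_sd s d j)) <= 0)
                    || (u (etavar d j) == (h0 P)%:R + g s d)]]].

Definition source_rules u : bool :=
  [forall s, forall j,
     [&& \sum_(d : dst P) u (yvar (arc_ds d s (half1_pred j)))
         + \sum_(k < kappa s) u (yvar (arc_s k (before j))) <= (kappa s)%:R,
         \sum_(d : dst P) u (yvar (arc_ds d s (half1_pred j)))
         + \sum_(k < kappa s) u (yvar (arc_s k (before j))) ==
         \sum_(d : dst P) u (yvar (arc_sd s d j))
         + \sum_(k < kappa s) u (yvar (arc_s k (half1 j))),
         \sum_(d : dst P) u (fvar (arc_ds d s (half1_pred j)))
         + \sum_(k < kappa s) u (fvar (arc_s k (before j))) + u (rvar s j) ==
         \sum_(d : dst P) u (fvar (arc_sd s d j))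
         + \sum_(k < kappa s) u (fvar (arc_s k (half1 j))),
         [forall k : 'I_(kappa s), forall k' : 'I_(kappa s),
            (k' == k.+1 :> nat) ==>
              (u (yvar (arc_s k' (half1 j))) <= u (yvar (arc_s k (half1 j))))]
       & [forall k : 'I_(kappa s),
            (u (fvar (arc_s k (half1 j))) == u (fvar (arc_s k (half2 j))))
            && (u (yvar (arc_s k (half1 j))) ==
                  u (yvar (arc_s k (half2 j))))]]].

(** The matrix entry at (l, l') is 1 when sigma maps l to l'. *)
Definition swap_rules u : bool :=
  [forall s, forall j, forall l : slot s, forall l' : slot s,
     (u (sigmavar j l l') <= 0) ||
       (u (fvar (in_arc j l)) <= u (fvar (out_arc j l')))].

(** The matrix is the graph of a bijection from the slots used on arrival to
those used on departure. *)
Definition assignment_rules u : bool :=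
  [forall s, forall j,
     [forall l : slot s,
        \sum_(l' : slot s) u (sigmavar j l l') == u (yvar (in_arc j l))]
     && [forall l' : slot s,
        \sum_(l : slot s) u (sigmavar j l l') == u (yvar (out_arc j l'))]].

Definition rules u : bool :=
  [&& arc_rules u, demand_rules u, visit_rules u, source_rules u, swap_rules u
    & assignment_rules u].

Lemma cnf_rules (K : finType) :
  cnf (fun x : pvar P + K -> R => rules (fun v => x (inl v))).
Proof.
rewrite /rules /arc_rules /demand_rules /visit_rules /source_rules /swap_rules.
rewrite /assignment_rules /visit_sum; cnf.
Qed.

(** * Feasible solutions and rules *)

Lemma demand1E p d j : demand1 p d j = cumul d j (eta p d j).
Proof.
rewrite /demand1 (bigD1 (eta p d j)) //= eqxx mul1r big1 ?addr0 // => h.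
by rewrite eq_sym => /negbTE->; rewrite mul0r.
Qed.

Lemma visit_sumE p d j : visit_sum (coordinate p) d j = (visits p d j)%:R.
Proof. by rewrite /visit_sum -natr_sum. Qed.

Lemma eqr_bool (b c : bool) : (b%:R == c%:R :> R) = (b == c).
Proof. by rewrite eqr_nat; case: b c => [] []. Qed.

Lemma feasible_rules p : feasible p ->
  box var_max var_int (coordinate p) /\ rules (coordinate p).
Proof.
move=> Fp; split.
  apply/forallP => v; apply/andP; split; last first.
    by apply/implyP; case: v => [[[[[a|a]|[s j]]|[d i]]|[d j]]|[s [j [l l']]]]
      //= _; apply: natr_int.
  case: v => [[[[[a|a]|[s j]]|[d i]]|[d j]]|[s [j [l l']]]] //=.
  - by rewrite ler0n lern1 leq_b1.
  - exact: f_range.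
  - by rewrite r_ge0 //= C17.
  - exact: z_range.
  - by rewrite ler0n ler_nat -ltnS ltn_ord.
  - by rewrite ler0n lern1 leq_b1.
apply/and5P; split.
- apply/and3P; split.
  + apply/forallP => a /=; rewrite ler1n lt0b.
    by have [//|fa_gt0] := leP (f p a) 0; apply: C1 fa_gt0.
  + by apply/forallP => a /=; rewrite y_init // f_init // !eqxx.
  + by apply/forallP => d; apply/forallP => i /=; rewrite C2.
- apply/forallP => d; apply/forallP => j /=; rewrite -C3 // eqxx /=.
  apply/forallP => h; rewrite !natr1 !ler_nat.
  case: ltngtP => //= /val_inj <-.
  by rewrite C5 // C13 // /demand2 demand1E !eqxx.
- apply/forallP => d; apply/forallP => j; rewrite visit_sumE /=.
  rewrite lern1 C6 // -natr_sum -C7 // eqxx ler1n lern0 /=.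
  have E8 := C8 Fp d j; have E9 := C9 Fp d j.
  apply/and3P; split.
  + have [v0|//] := posnP; rewrite v0 eqxx !mul1r in E8 E9.
    rewrite (C11 Fp v0) E9 !eqxx !andbT; apply/eqP.
    by apply: (addrI (f p (arc_dd d (half1 j)))); rewrite addr0 -E8.
  + have [//|v1] := eqVneq; rewrite (negbTE v1) !mul0r addr0 add0r in E8 E9.
    by rewrite -E8 -E9 !eqxx.
  + apply/forallP => s; rewrite lern0 eqb0.
    by have [ys|//] := boolP (y p _); rewrite (C10 Fp ys) eqxx.
- apply/forallP => s; apply/forallP => j /=.
  rewrite -!natr_sum -!natrD ler_nat C14 // C15 // C16 // !eqxx /=.
  apply/andP; split.
    apply/forallP => k; apply/forallP => k'; apply/implyP => /eqP kk'.
    rewrite ler_nat; case: (boolP (y p _)) => //.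
    by move=> /(C19 Fp kk')->.
  by apply/forallP => k; rewrite C20_f // C20_y // !eqxx.
- apply/andP; split; apply/forallP => s; apply/forallP => j.
    apply/forallP => l; apply/forallP => l' /=; rewrite lern0 eqb0.
    have [/existsP[w /andP[/eqP<- /eqP<-]]|//] := boolP (sigma_graph _ _ _ _).
    exact: C18_le.
  have [rowE colE] := bijection_graph (@sigma R P p s j).
  apply/andP; split; apply/forallP => l; rewrite /= -natr_sum eqr_nat.
    by rewrite -rowE.
  by rewrite -(colE (C18_bij Fp s j)).
Qed.

(** The bijectivity of sigma is a hypothesis here because [decode] produces it
together with the solution. *)
Lemma rules_feasible p :
  (forall s j, bijective (@sigma R P p s j)) ->
  box var_max var_int (coordinate p) -> rules (coordinate p) -> feasible p.
Proof.
move=> sigma_bij /forallP Bp.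
have range v : 0 <= coordinate p v <= var_max v by have /andP[] := Bp v.
case/and5P=> /and3P[/forallP A1 /forallP A2 /forallP A3] /forallP Dem.
move=> /forallP Vis /forallP Src /andP[/forallP Swap _].
have DemE d j : [/\ f p (arc_dd d (half1 j)) =
      f p (arc_dd d (before j)) - z p d (inl j),
    z p d (inl j) = Num.min (f p (arc_dd d (before j))) (demand1 p d j)
  & z p d (inr j) = Num.min (f p (arc_dd d (half1 j))) (demand2 p d j)].
  have /forallP/(_ j)/andP[/eqP E3 /forallP/(_ (eta p d j))] := Dem d.
  (* At h = eta the two strict inequalities fail. *)
  rewrite /= natr1 ler_nat ltnn /= => /andP[/eqP E5 /eqP E13].
  by rewrite /demand2 demand1E.
have VisE d j := and5P (forallP (Vis d) j).
have SrcE s j := and5P (forallP (Src s) j).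
split=> //.
- by move=> a; apply: range (fvar a).
- by move=> d i; apply: range (zvar d i).
- by move=> s j; have /andP[] := range (rvar s j).
- by move=> a; have /andP[+ _] := A2 a; rewrite /= eqr_bool => /eqP.
- by move=> a; have /andP[_ /eqP] := A2 a.
- by move=> a; have := A1 a; rewrite /= ler1n lt0b leNgt => /orP[/negbTE->|].
- by move=> d i; have := forallP (A3 d) i; rewrite /= pnatr_eq1 eqb1.
- by move=> d j; have [] := DemE d j.
- by move=> d j; have [] := DemE d j.
- by move=> d j; have [+ _ _ _ _] := VisE d j; rewrite visit_sumE lern1.
- move=> d j; have [_ /eqP + _ _ _] := VisE d j.
  by rewrite visit_sumE /= -natr_sum => /eqP; rewrite eqr_nat => /eqP.
- move=> d j; have [_ _ + + _] := VisE d j.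
  rewrite visit_sumE ler1n lern0 lt0n.
  case: eqVneq => [v0 /and3P[/eqP S0 _ _] _|].
    by rewrite mul1r -[X in _ + X]S0 addr0.
  by move=> _ _ /andP[/eqP E8 _]; rewrite mul0r add0r; exact: E8.
- move=> d j; have [_ _ + + _] := VisE d j.
  rewrite visit_sumE ler1n lern0 lt0n.
  case: eqVneq => [v0 /and3P[_ /eqP E9 _] _|].
    by rewrite mul1r.
  by move=> _ _ /andP[_ /eqP E9]; rewrite mul0r addr0.
- move=> s d j ys; have [_ _ _ _ /forallP/(_ s)] := VisE d j.
  by rewrite /= ys lern0 /= => /eqP.
- move=> d j v0; have [_ _ + _ _] := VisE d j.
  rewrite visit_sumE v0 ler10 /= => /and3P[_ _].
  by rewrite eqr_nat => /eqP.
- by move=> d j; have [] := DemE d j.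
- move=> s j; have [+ _ _ _ _] := SrcE s j.
  by rewrite /= -!natr_sum -natrD ler_nat.
- move=> s j; have [_ + _ _ _] := SrcE s j.
  by rewrite /= -!natr_sum -!natrD eqr_nat => /eqP.
- by move=> s j; have [_ _ /eqP + _ _] := SrcE s j.
- by move=> s j; have /andP[] := range (rvar s j).
- move=> s j l; have /forallP/(_ j)/forallP/(_ (val l)) := Swap s.
  move=> /forallP/(_ (val (sigma l))) /=; rewrite lern0 eqb0.
  case/orP => // /negP[]; apply/existsP; exists l.
  by rewrite !eqxx.
- move=> s j k k' kk'; have [_ _ _ + _] := SrcE s j.
  move=> /forallP/(_ k)/forallP/(_ k'); rewrite kk' eqxx /= ler_nat.
  by case: (y p _) => // + _; case: (y p _).
- move=> s j k; have [_ _ _ _ /forallP/(_ k)/andP[/eqP + _]] := SrcE s j.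
  by [].
- move=> s j k; have [_ _ _ _ /forallP/(_ k)/andP[_]] := SrcE s j.
  by rewrite /= eqr_bool => /eqP.
Qed.

Lemma box_int01 (V : finType) (hi : V -> R) (int : pred V) (x : V -> R) v :
  box hi int x -> hi v = 1 -> int v -> x v = (x v == 1)%:R.
Proof.
move=> /forallP/(_ v)/andP[+ /implyP int_x] hi1 int_v.
by rewrite hi1 => x01; apply: int01 => //; apply: int_x.
Qed.

(** The integer coordinates of a point of the box are truth values or hours; the
bijections come from [graph_bijection]. *)
Lemma decode u : box var_max var_int u -> assignment_rules u ->
  exists2 p, coordinate p =1 u & forall s j, bijective (@sigma R P p s j).
Proof.
move=> Bu /forallP asg.
pose yu a := u (yvar a) == 1.
pose gu s j (l l' : slot s) := u (sigmavar j l l') == 1.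
have yE a : u (yvar a) = (yu a)%:R by apply: box_int01 Bu _ _.
have gE s j l l' : u (sigmavar j l l') = (@gu s j l l')%:R.
  by apply: box_int01 Bu _ _.
have sg s j : exists2 sg : {l : slot s | yu (in_arc j l)} ->
    {l | yu (out_arc j l)}, bijective sg &
    forall l l', [exists w, (val w == l) && (val (sg w) == l')] = gu s j l l'.
  have /forallP/(_ j)/andP[/forallP row /forallP col] := asg s.
  apply: graph_bijection => l.
    apply/eqP; rewrite -(eqr_nat R) -yE -(eqP (row l)) natr_sum.
    by apply/eqP/eq_bigr => l' _; rewrite gE.
  apply/eqP; rewrite -(eqr_nat R) -yE -(eqP (col l)) natr_sum.
  by apply/eqP/eq_bigr => l' _; rewrite gE.
pose eu d j : 'I_24 := inord (Num.truncn (u (etavar d j))).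
have eE d j : u (etavar d j) = (eu d j)%:R.
  have /forallP/(_ (etavar d j))/andP[/andP[e0 e23]] := Bu.
  rewrite /= intrEge0 // => e_nat; rewrite inordK ?truncnK //.
  by rewrite ltnS -(ler_nat R) truncnK.
exists (@Solution R P yu (fun a => u (fvar a)) (fun s j => u (rvar s j))
          (fun d i => u (zvar d i)) eu (fun s j => s2val (cid2 (sg s j)))).
  case=> [[[[[a|a]|[s j]]|[d i]]|[d j]]|[s [j [l l']]]] //=.
  - by rewrite -yE.
  - by rewrite -eE.
  - by rewrite /sigma_graph (s2valP' (cid2 (sg s j))) -gE.
by move=> s j; exact: (s2valP (cid2 (sg s j))).
Qed.


(** * Charges for shortages *)

Definition unmet u d j : R :=
  cumul d j ord_max - (u (zvar d (inl j)) + u (zvar d (inr j))).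

(** The two demands of a day add up to its total demand, so that the shortage is
affine although each of them is a nonlinear function of the swap hour. *)
Lemma unmetE p d j : unmet (coordinate p) d j = shortage p d j.
Proof. by rewrite /unmet /shortage /demand2 [demand1 _ _ _ + _]addrC subrK. Qed.

Notation charged := (pvar P + dst P * 'I_(J P))%type.

Definition charged_max (v : charged) : R :=
  if v is inl w then var_max w else 1.

Definition charged_int (v : charged) : bool :=
  if v is inl w then var_int w else false.

(** A charge need not be an integer: in [0, 1], it equals 1 as soon as it is at
least 1. *)
Definition charge_rules (x : charged -> R) : bool :=
  [forall d, forall j, (unmet (x \o inl) d j <= 0) || (1 <= x (inr (d, j)))].

Definition charged_cost (x : charged -> R) : R :=
  c_tr P * (\sum_(a : arcs P | ~~ parallel a)
              transport (arc_tail a) (arc_head a) * x (inl (yvar a)))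
  + \sum_(s : src P) \sum_(j < J P) c_re s * x (inl (rvar s j))
  + c_v P * (\sum_(d : dst P) \sum_(j < J P) unmet (x \o inl) d j)
  + c_f P * (\sum_(d : dst P) \sum_(j < J P) x (inr (d, j))).

Lemma affine_charged_cost : affine charged_cost.
Proof. rewrite /charged_cost /unmet /=; affine. Qed.

Lemma cnf_charged : cnf (fun x => rules (x \o inl) && charge_rules x).
Proof.
apply: cnf_and; first exact: cnf_rules.
by rewrite /charge_rules /unmet; cnf.
Qed.

Definition charge p (v : charged) : R :=
  match v with
  | inl w => coordinate p w
  | inr (d, j) => (0 < shortage p d j)%R%:R
  end.

Lemma charge_feasible p : feasible p ->
  [/\ box charged_max charged_int (charge p), rules (charge p \o inl),
      charge_rules (charge p) & charged_cost (charge p) = objective p].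
Proof.
move=> /feasible_rules[/forallP Bp Rp]; split=> //.
- apply/forallP => -[v|[d j]] /=; first exact: Bp.
  by rewrite ler0n lern1 leq_b1.
- apply/forallP => d; apply/forallP => j.
  by rewrite unmetE /= ler1n lt0b leNgt orNb.
- rewrite /charged_cost /objective; congr (_ + c_v P * _ + _).
  by apply: eq_bigr => d _; apply: eq_bigr => j _; exact: unmetE.
Qed.

(** The charge is at least the indicator of a positive shortage, and it is
weighted by a nonnegative cost. *)
Lemma feasible_charged (x : charged -> R) :
  box charged_max charged_int x -> rules (x \o inl) -> charge_rules x ->
  exists p, [/\ feasible p, x \o inl =1 coordinate p
             & objective p <= charged_cost x].
Proof.
move=> /forallP Bx Rx Cx.
have Bu : box var_max var_int (x \o inl).
  by apply/forallP => v; apply: Bx (inl v).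
have [p /funext pE bij_p] : exists2 p, coordinate p =1 x \o inl &
    forall s j, bijective (@sigma R P p s j).
  by apply: decode => //; have /and5P[_ _ _ _ /andP[]] := Rx.
exists p; split; first by apply: rules_feasible; rewrite ?pE.
  by rewrite pE.
have xE v : x (inl v) = coordinate p v by rewrite pE.
rewrite /charged_cost /objective.
under [X in _ <= c_tr P * X + _ + _ + _]eq_bigr do rewrite xE.
under [X in _ <= _ + X + _ + _]eq_bigr do under eq_bigr do rewrite xE.
under [X in _ <= _ + _ + c_v P * X + _]eq_bigr do
  under eq_bigr do rewrite -pE unmetE.
rewrite lerD2l ler_wpM2l ?c_f_ge0 //.
apply: ler_sum => d _; apply: ler_sum => j _.
have := forallP (forallP Cx d) j; rewrite -pE unmetE.
have /andP[/andP[x_ge0 _] _] := Bx (inr (d, j)).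
by rewrite leNgt; case: (0 < shortage p d j)%R.
Qed.

End Model.

(** * The equivalent mixed-integer linear program *)

Theorem mainTheorem1 (R : realType) (P : data R) :
  exists (n : nat) (M : milp R (pvar P + 'I_n)%type),
    [/\ optimal_value (@feasible R P) (@objective R P) =
          optimal_value (milp_feasible M) (milp_objective M),
        forall p, feasible p ->
          exists x, [/\ milp_feasible M x, represents x p
                      & milp_objective M x = objective p],
        forall x, milp_feasible M x ->
          exists p, [/\ feasible p, represents x p
                      & objective p <= milp_objective M x],
        forall p, is_optimal (@feasible R P) (@objective R P) p ->
          exists x, is_optimal (milp_feasible M) (milp_objective M) x /\
                    represents x p
      & forall x, is_optimal (milp_feasible M) (milp_objective M) x ->
          exists p, is_optimal (@feasible R P) (@objective R P) p /\
                    represents x p].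
Proof.
have [n [M [to_milp of_milp]]] := milp_of_cnf (@charged_max R P)
  (@charged_int R P) (@cnf_charged R P) (@affine_charged_cost R P).
exists n, M.
have FG p : feasible p ->
    exists x, [/\ milp_feasible M x, represents x p
                & milp_objective M x = objective p].
  move=> /charge_feasible[Bp Rp Cp <-].
  have [|x [Mx xE ox]] := to_milp _ Bp; first by rewrite Rp.
  by exists x.
have GF x : milp_feasible M x ->
    exists p, [/\ feasible p, represents x p
                & objective p <= milp_objective M x].
  move=> /of_milp[w [Bw /andP[Rw Cw] wE ->]].
  have [p [Fp pE le_p]] := feasible_charged Bw Rw Cw.
  by exists p; split=> // v; rewrite -wE -pE.
by have [? ? ?] := optima_transfer FG GF.
Qed.
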